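(* Let $G\in\mathscr{G}_{a,b}$, let $u,v\in V(G_0)$ with $d(u)=d(v)$, and suppose $N_{G_0}(u)=\{u',u''\}$ and $N_{G_0}(v)=\{v',v''\}$. Then $d(u')=d(v')$ if and only if $d(u'')=d(v'')$.
   Context: Graphs are finite, simple and connected; $d(v)$ denotes the degree of $v$ in $G$ and $s(v)=\sum_{u\in N_G(v)}d(u)$. A graph $G$ is 2-walk $(a,b)$-parabolic if there exist uniquely a positive integer $a$ and a non-negative integer $b$ such that $a^2-8b>0$ and $s(v)=-d(v)^2+a\,d(v)-b$ for all $v\in V(G)$. A bicyclic graph is a simple connected graph with number of edges equal to number of vertices plus one. $\mathscr{G}_{a,b}$ is the set of 2-walk $(a,b)$-parabolic bicyclic graphs $G$ with minimum degree $\delta(G)=1$. For $G\in\mathscr{G}_{a,b}$, $G_0$ is the graph obtained from $G$ by deleting all pendant (degree-1) vertices, $N_{G_0}(v)$ is the neighbourhood of $v$ in $G_0$ and $d_{G_0}(v)$ its degree in $G_0$. *)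

(* Defs.v *)
From mathcomp Require Import all_boot all_order all_algebra.
Set Implicit Arguments.
Unset Strict Implicit.
Unset Printing Implicit Defensive.
Import Order.TTheory GRing.Theory Num.Theory.

Record sgraph := SGraph {
  vertex :> finType;
  adj : rel vertex;
  adj_sym : symmetric adj;
  adj_irrefl : irreflexive adj }.

Section Graph.
Variable G : sgraph.

Definition nbhd (v : G) : {set G} := [set u | adj v u].

Definition deg (v : G) : nat := #|nbhd v|.

Definition nbr_deg_sum (v : G) : nat := (\sum_(u in nbhd v) deg u)%N.

Definition edges : {set {set G}} :=
  [set A | [exists x, exists y, adj x y && (A == [set x; y])]].

Definition connected : Prop := forall x y : G, connect (@adj G) x y.

(* The unit #|G| is harmless: degrees are smaller than #|G|. *)
Definition min_degree : nat := \big[minn/#|G|]_(v : G) deg v.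

(* The vertex set is not required to be nonempty in [connected]; here the edge
   count forces it. *)
Definition bicyclic : Prop := connected /\ #|edges| = (#|G| + 1)%N.

Definition parabola (p : int * int) : Prop :=
  let: (a, b) := p in
  [/\ (0 < a)%R, (0 <= b)%R, (0 < a ^+ 2 - 8 * b)%R &
    forall v : G,
      ((nbr_deg_sum v)%:Z = - (deg v)%:Z ^+ 2 + a * (deg v)%:Z - b)%R].

(* "There exist uniquely a and b": (a, b) is the only admissible pair. *)
Definition two_walk_parabolic (a b : int) : Prop := unique parabola (a, b).

Section Induced.
Variable S : {set G}.
Let sadj : rel {x | x \in S} := fun x y => adj (val x) (val y).

Fact induced_sym : symmetric sadj.
Proof. by move=> x y; apply: adj_sym. Qed.

Fact induced_irrefl : irreflexive sadj.
Proof. by move=> x; apply: adj_irrefl. Qed.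

Definition induced : sgraph := SGraph induced_sym induced_irrefl.
End Induced.

Definition non_pendant : {set G} := [set v | deg v != 1].

Definition del_pendant : sgraph := induced non_pendant.

Definition base_vertex (v : del_pendant) : G := val v.

End Graph.

Definition parabolic_bicyclic (a b : int) (G : sgraph) : Prop :=
  [/\ bicyclic G, two_walk_parabolic G a b & min_degree G = 1].

(* Main.v *)
Require Import Defs.
From mathcomp Require Import all_boot all_order all_algebra.
From mathcomp Require Import zify.

(** Each pendant neighbour of [w] contributes exactly 1 to [s(w)], so [s(w) - d(w)]
    is the sum of [d(x) - 1] over the neighbours [x] of [w] in [G_0]. The parabolic
    condition makes [s], hence this sum, a function of [d(w)] alone, and each of
    its terms is positive. *)

Lemma deg_gt0_of_adj (G : sgraph) (x y : G) : adj x y -> 0 < deg y.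
Proof. by move=> xy; apply/card_gt0P; exists x; rewrite inE adj_sym. Qed.

Lemma nbhd_non_pendant (G : sgraph) (w : del_pendant G) :
  nbhd (base_vertex w) :&: non_pendant G = [set base_vertex x | x in nbhd w].
Proof.
apply/setP => x; rewrite inE; apply/andP/imsetP => [[wx xG0] | [y wy ->]].
  by exists (exist _ x xG0); rewrite // inE; rewrite inE in wx.
by split; [rewrite inE in wy; rewrite inE | exact: (valP y)].
Qed.

Lemma nbr_deg_sum_del_pendant (G : sgraph) (w : del_pendant G) :
  nbr_deg_sum (base_vertex w) =
  deg (base_vertex w) + \sum_(x in nbhd w) (deg (base_vertex x)).-1.
Proof.
have -> : nbr_deg_sum (base_vertex w) =
    \sum_(x in nbhd (base_vertex w)) (1 + (deg x).-1).
  (* The truncated predecessor loses nothing: [x] is adjacent to [w], so its degree is positive. *)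
  apply: eq_bigr => x; rewrite inE => /(deg_gt0_of_adj _ _ _); lia.
rewrite big_split /= sum1_card; congr (_ + _).
(* Pendant neighbours have [(deg x).-1 = 0], so only the neighbours in $G_0$ survive. *)
rewrite (big_setID (non_pendant G)) /= [X in _ + X]big1 ?addn0.
  rewrite nbhd_non_pendant big_imset //; exact: in2W val_inj.
by move=> x; rewrite !inE negbK => /andP[/eqP->].
Qed.

Lemma parabola_nbr_deg_sum (G : sgraph) (p : int * int) (x y : G) :
  parabola G p -> deg x = deg y -> nbr_deg_sum x = nbr_deg_sum y.
Proof. by case: p => a b [_ _ _ par] xy; have := par x; rewrite xy -par => -[]. Qed.

(** Being non-pendant only excludes degree 1; the neighbour [w] excludes degree 0. *)
Lemma deg_gt1_of_nbhd (G : sgraph) (w x : del_pendant G) :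
  x \in nbhd w -> 1 < deg (base_vertex x).
Proof.
rewrite inE => /(deg_gt0_of_adj _ (base_vertex w) (base_vertex x)) x0.
by have := valP x; rewrite inE -/(base_vertex x); lia.
Qed.

(* When [u' = u''] or [v' = v''] but not both, both sides of the equivalence are
   false, since the extra term is positive. *)
Theorem lemma7 (a b : int) (G : sgraph) (hG : parabolic_bicyclic a b G)
  (u v u' u'' v' v'' : del_pendant G)
  (huv : deg (base_vertex u) = deg (base_vertex v))
  (hu : nbhd u = [set u'; u'']) (hv : nbhd v = [set v'; v'']) :
  deg (base_vertex u') = deg (base_vertex v') <->
  deg (base_vertex u'') = deg (base_vertex v'').
Proof.
case: hG => _ [par _] _.
have := parabola_nbr_deg_sum _ _ _ _ par huv.
rewrite !nbr_deg_sum_del_pendant huv => /addnI.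
have u'1 : 1 < deg (base_vertex u').
  by apply: (@deg_gt1_of_nbhd _ u); rewrite hu set21.
have u''1 : 1 < deg (base_vertex u'').
  by apply: (@deg_gt1_of_nbhd _ u); rewrite hu set22.
have v'1 : 1 < deg (base_vertex v').
  by apply: (@deg_gt1_of_nbhd _ v); rewrite hv set21.
have v''1 : 1 < deg (base_vertex v'').
  by apply: (@deg_gt1_of_nbhd _ v); rewrite hv set22.
rewrite hu hv.
have [eu|nu] := eqVneq u' u''; have [ev|nv] := eqVneq v' v''.
- by rewrite eu ev.
- by rewrite eu setUid big_set1 big_setU1 ?inE //= big_set1; lia.
- by rewrite ev setUid big_set1 big_setU1 ?inE //= big_set1; lia.
(* Here $d(u')+d(u'')=d(v')+d(v'')$, so equality of one pair of degrees forces that of the other. *)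
- by rewrite !big_setU1 ?inE //= !big_set1; lia.
Qed.
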